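(* Let $\ell\ge5$ be an odd integer and $n=\frac{3^\ell+1}{4}$. Let $\beta$ be a primitive $2n$-th root of unity in an extension field of $\mathrm{GF}(3)$ and let $\mathbb{M}_\beta(x)$ be its minimal polynomial over $\mathrm{GF}(3)$. Let $\mathcal{C}(\ell)$ be the ternary negacyclic code of length $n$ with check polynomial $\mathbb{M}_\beta(x)$. Then $\mathcal{C}(\ell)$ has parameters $[n,2\ell,d]$ with $d\ge\frac{3^{\ell-1}-1}{4}$, and $\mathcal{C}(\ell)^\perp$ has parameters $[n,n-2\ell,d^\perp]$ with $5\le d^\perp\le 6$.
   Context: A ternary negacyclic code of length $n$ is an ideal of $\mathrm{GF}(3)[x]/(x^n+1)$; a code with check polynomial $h(x)$ (a monic divisor of $x^n+1$) is the one with generator polynomial $(x^n+1)/h(x)$. $[n,k,d]$ denotes length, dimension, minimum Hamming distance; $\perp$ is the Euclidean dual. *)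

(* Defs.v *)
From HB Require Import structures.
From mathcomp Require Import all_boot all_order all_algebra all_field.
Set Implicit Arguments. Unset Strict Implicit. Unset Printing Implicit Defensive.
Import GRing.Theory.
Local Open Scope ring_scope.

Notation F3 := 'F_3.

Definition poly_of_word n (c : 'rV[F3]_n) : {poly F3} :=
  \sum_(i < n) c 0 i *: 'X^i.

(* Ternary negacyclic code of length n with check polynomial h
   (h a monic divisor of x^n+1): the ideal of GF(3)[x]/(x^n+1) generated by
   g = (x^n+1)/h, i.e. the words whose polynomial (degree < n) is a multiple of g. *)
Definition negacyclic_code n (h : {poly F3}) : {set 'rV[F3]_n} :=
  [set c | (('X^n + 1) %/ h) %| poly_of_word c].

Definition dual_code n (C : {set 'rV[F3]_n}) : {set 'rV[F3]_n} :=
  [set v | [forall c in C, v *m c^T == 0]].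

Definition code_dim n (C : {set 'rV[F3]_n}) : nat := \dim (<< enum C >>%VS).

Definition wt n (c : 'rV[F3]_n) : nat := #|[set i | c 0 i != 0]|.

(* Minimum Hamming distance (= minimum weight of a nonzero codeword);
   convention: n if the code has no nonzero word. *)
Definition min_dist n (C : {set 'rV[F3]_n}) : nat :=
  \big[minn/n]_(c in C | c != 0) wt c.

Definition is_minpoly (L : fieldType) (f : {rmorphism F3 -> L})
    (M : {poly F3}) (beta : L) : Prop :=
  [/\ M \is monic, root (map_poly f M) beta &
      forall p : {poly F3}, p != 0 -> root (map_poly f p) beta ->
        (size M <= size p)%N].

(* Main.v *)
(* Write 4n = 3^l + 1. Modulo 2n one has 3^l = -1, so the conjugates of beta are
   beta^(3^i) and beta^(-3^i), i < l; they are pairwise distinct, whence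
   deg M = 2l, and M is self-reciprocal up to a constant, so the dual code
   consists of the multiples of M. No conjugate has an odd exponent strictly
   between (3^(l-1) + 1)/2 and 3^(l-1), and the BCH bound on this gap bounds
   d from below. In the dual the zeros beta^-3, beta^-1, beta, beta^3 give
   d >= 5 by the BCH bound, while a sphere-packing count excludes d >= 7. *)
Require Import Defs.
From HB Require Import structures.
From mathcomp Require Import all_boot all_order all_algebra all_field.
From mathcomp Require Import zify.
Set Implicit Arguments. Unset Strict Implicit. Unset Printing Implicit Defensive.
Import GRing.Theory.
Local Open Scope ring_scope.

(** * Words as polynomials of degree less than [n] *)

Lemma poly_of_wordE n (c : 'rV[F3]_n) : poly_of_word c = rVpoly c.
Proof.
by rewrite /poly_of_word /rVpoly poly_def; apply: eq_bigr => i _; rewrite valK.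
Qed.

Lemma coef_poly_of_word n (c : 'rV[F3]_n) (i : 'I_n) :
  (poly_of_word c)`_i = c 0 i.
Proof. by rewrite poly_of_wordE coef_rVpoly_ord. Qed.

Lemma size_poly_of_word n (c : 'rV[F3]_n) : (size (poly_of_word c) <= n)%N.
Proof. by rewrite poly_of_wordE size_poly. Qed.

Lemma poly_of_word_eq0 n (c : 'rV[F3]_n) : (poly_of_word c == 0) = (c == 0).
Proof. by rewrite poly_of_wordE raddf_eq0 //; apply: can_inj rVpolyK. Qed.

(** * Words divisible by a fixed polynomial, and their dimension *)

Definition multiples n (g : {poly F3}) : {set 'rV[F3]_n} :=
  [set c | g %| poly_of_word c].

(** Composed of linear maps, so that for [size g = k.+1] the multiples of [g] form the kernel of a
    linear map. *)
Definition residue n k (g : {poly F3}) (c : 'rV[F3]_n) : 'rV[F3]_k :=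
  poly_rV (rVpoly c %% g).

Fact residue_is_linear n k g : linear (@residue n k g).
Proof.
by move=> a u v; rewrite /residue linearP modpD modpZl linearP.
Qed.

HB.instance Definition _ n k g :=
  GRing.isLinear.Build F3 'rV[F3]_n 'rV[F3]_k *:%R (@residue n k g)
    (@residue_is_linear n k g).

Lemma residue_eq0 n k (g : {poly F3}) (c : 'rV[F3]_n) :
  size g = k.+1 -> (residue k g c == 0) = (c \in multiples n g).
Proof.
move=> sg; rewrite inE /dvdp -poly_of_word_eq0 !poly_of_wordE.
by rewrite poly_rV_K // -ltnS -sg ltn_modp -size_poly_gt0 sg.
Qed.

(** Rank-nullity for [residue], which is onto: a polynomial of degree less than [k] is its own
    remainder modulo [g]. *)
Lemma code_dim_multiples n k (g : {poly F3}) :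
  size g = k.+1 -> (k <= n)%N -> code_dim (multiples n g) = (n - k)%N.
Proof.
move=> sg kn; pose phi : 'Hom('rV[F3]_n, 'rV[F3]_k) := linfun (residue k g).
have kerE c : (c \in lker phi) = (c \in multiples n g).
  by rewrite memv_ker lfunE residue_eq0.
have -> : code_dim (multiples n g) = \dim (lker phi).
  rewrite /code_dim; congr (\dim _); apply/eqP; rewrite eqEsubv; apply/andP.
  split; first by apply/span_subvP => c; rewrite mem_enum kerE.
  by apply/subvP => c; rewrite kerE => ?; apply: memv_span; rewrite mem_enum.
have img : limg phi = fullv.
  apply/eqP; rewrite eqEsubv subvf; apply/subvP => v _.
  apply/memv_imgP; exists (poly_rV (rVpoly v)); first exact: memvf.
  rewrite lfunE /= /residue poly_rV_K ?modp_small ?rVpolyK // ?sg ?ltnS ?size_poly //.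
  exact: leq_trans (size_poly _ _) kn.
have := limg_ker_dim phi fullv.
by rewrite capfv img !dimvf /dim /= !mul1n => dimE; lia.
Qed.

(** * The Euclidean dual *)

Lemma eq_dot_poly n (u v : 'rV[F3]_n) :
  (u *m v^T == 0) = (\sum_(i < n) (poly_of_word u)`_i * (poly_of_word v)`_i == 0).
Proof.
have -> : \sum_(i < n) (poly_of_word u)`_i * (poly_of_word v)`_i = (u *m v^T) 0 0.
  by rewrite mxE; apply: eq_bigr => i _; rewrite !coef_poly_of_word mxE.
apply/eqP/eqP => [->|uv0]; first by rewrite mxE.
by apply/matrixP => i j; rewrite !ord1 uv0 mxE.
Qed.

(* Coefficient k of M c with deg M <= k < n vanishes because M c is
   (X^n + 1) q with deg q < deg M; up to the constant e it is the inner
   product of c with a shift of M. *)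
Lemma shift_dot0 n k (M c : {poly F3}) (e : F3) (i : nat) :
  size M = k.+1 -> (k <= n)%N -> M %| 'X^n + 1 ->
  (forall t, (t <= k)%N -> M`_t = e * M`_(k - t)) ->
  (('X^n + 1) %/ M) %| c -> (size c <= n)%N -> (i + k < n)%N ->
  \sum_(j < n) ('X^i * M)`_j * c`_j = 0.
Proof.
move=> sM kn dM symM /dvdpP[q cE] sc ikn.
have M0 : M != 0 by rewrite -size_poly_gt0 sM.
have McE : M * c = q * ('X^n + 1).
  by rewrite cE mulrC -mulrA divpK.
have coef0 : (M * c)`_(i + k) = 0.
  rewrite McE mulrDr mulr1 coefD coefMXn ikn add0r nth_default //.
  have [->|q0] := eqVneq q 0; first by rewrite size_poly0.
  have sX : size ('X^n + 1 : {poly F3}) = n.+1.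
    by rewrite size_polyDl ?size_polyXn // size_poly1 ltnS; lia.
  have sq : size (M * c) = (size q + n)%N.
    by rewrite McE size_mul // ?sX ?addnS // -size_poly_gt0 sX.
  have := size_polyMleq M c; rewrite sq sM; move: sc; move: (size c) (size q) => a b; lia.
have lhsE : \sum_(j < n) ('X^i * M)`_j * c`_j = \sum_(t < k.+1) M`_t * c`_(i + t).
  rewrite -(big_mkord xpredT (fun j => ('X^i * M)`_j * c`_j)).
  rewrite (big_cat_nat (n := i)) //=; last by lia.
  rewrite big_nat_cond big1 ?add0r; last first.
    by move=> j /andP[/andP[_ ji] _]; rewrite coefXnM ji mul0r.
  rewrite -{1}[i]add0n big_addn (big_cat_nat (n := k.+1)) //=; last by lia.
  rewrite [X in _ + X]big_nat_cond [X in _ + X]big1 ?addr0; last first.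
    move=> j /andP[/andP[kj _] _].
    by rewrite coefXnM addnK [M`_j]nth_default ?sM // if_same mul0r.
  rewrite big_mkord; apply: eq_bigr => t _.
  by rewrite coefXnM addnK ltnNge leq_addl /= addnC.
(* After reversal, the symmetry of [M] turns this correlation into a convolution. *)
rewrite lhsE (reindex_inj rev_ord_inj) /=.
transitivity (e * (M * c)`_(i + k)); last by rewrite coef0 mulr0.
rewrite coefM mulr_sumr -(big_mkord xpredT (fun t => e * (M`_t * c`_(i + k - t)))).
rewrite (big_cat_nat (n := k.+1)) //=; last by lia.
rewrite [X in _ = _ + X]big_nat_cond [X in _ = _ + X]big1 ?addr0; last first.
  move=> j /andP[/andP[kj _] _].
  by rewrite [M`_j]nth_default ?sM // mul0r mulr0.
rewrite big_mkord; apply: eq_bigr => t _.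
have tk := ltn_ord t.
rewrite subSS symM ?leq_subr // subKn // mulrA.
by congr (_ * _`_ _); lia.
Qed.

(** Multiples of [M] are combinations of its shifts, which are orthogonal to the code. Conversely, a
    dual word is reduced modulo [M]; the remainder is again in the dual and must vanish. *)
Lemma dual_negacyclic n k (M : {poly F3}) (e : F3) :
  size M = k.+1 -> (0 < k <= n)%N -> M %| 'X^n + 1 ->
  (forall t, (t <= k)%N -> M`_t = e * M`_(k - t)) ->
  dual_code (negacyclic_code n M) = multiples n M.
Proof.
move=> sM /andP[k0 kn] dM symM.
have M0 : M != 0 by rewrite -size_poly_gt0 sM.
have sX : size ('X^n + 1 : {poly F3}) = n.+1.
  by rewrite size_polyDl ?size_polyXn // size_poly1 ltnS; lia.
pose g := ('X^n + 1) %/ M.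
have gM : g * M = 'X^n + 1 by rewrite divpK.
have g0 : g != 0 by apply/eqP => g0; move: sX; rewrite -gM g0 mul0r size_poly0.
have sg : size g = (n - k).+1.
  have : size (g * M) = n.+1 by rewrite gM.
  by rewrite size_mul // sM; move: (size g) => a; lia.
(* The constant term of [g * M] is 1 because [n > 0]. *)
have g00 : g`_0 != 0.
  apply/eqP => g00; have : (g * M)`_0 = 0 by rewrite coef0M g00 mul0r.
  rewrite gM coefD coefXn coef1 /= eq_sym (_ : (n == 0)%N = false); last by lia.
  by rewrite add0r => /eqP; rewrite oner_eq0.
have dual_sub v : v \in multiples n M -> v \in dual_code (negacyclic_code n M).
  rewrite !inE => /dvdpP[p vE]; apply/forall_inP => c; rewrite inE => gc.
  rewrite eq_dot_poly; apply/eqP.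
  (* This degree bound keeps every shift ['X^i * M] in the expansion of [v] within length [n]. *)
  have sp : (size p <= n - k)%N.
    have [->|p0] := eqVneq p 0; first by rewrite size_poly0.
    have := size_poly_of_word v; rewrite vE size_mul // sM; move: (size p) => a; lia.
  have -> : poly_of_word v = \sum_(i < n - k) p`_i *: ('X^i * M).
    rewrite vE {1}(_ : p = \sum_(i < n - k) p`_i *: 'X^i).
      by rewrite mulr_suml; apply: eq_bigr => i _; rewrite scalerAl.
    by rewrite -poly_def; apply/polyP => j; rewrite coef_poly; case: ltnP => // jn;
      rewrite nth_default // (leq_trans sp).
  under eq_bigr do rewrite coef_sum mulr_suml.
  rewrite exchange_big big1 //= => i _.
  under eq_bigr do rewrite coefZ -mulrA.
  rewrite -mulr_sumr (shift_dot0 (e := e) sM) ?mulr0 ?size_poly_of_word //.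
  have := ltn_ord i; lia.
apply/setP => v; apply/idP/idP; last exact: dual_sub.
move=> vC; pose r : 'rV[F3]_n := poly_rV (poly_of_word v %% M).
have sr : (size (poly_of_word v %% M)%R <= k)%N by rewrite -ltnS -sM ltn_modp.
have rE : poly_of_word r = poly_of_word v %% M.
  by rewrite poly_of_wordE poly_rV_K // (leq_trans sr).
suff r0 : poly_of_word r = 0 by rewrite inE /dvdp -rE r0.
have rC : r \in dual_code (negacyclic_code n M).
  have vr : v - r \in dual_code (negacyclic_code n M).
    apply: dual_sub; rewrite inE poly_of_wordE linearB /= -!poly_of_wordE rE.
    by rewrite {1}(divp_eq (poly_of_word v) M) addrK dvdp_mull.
  rewrite inE; apply/forall_inP => c cC.
  move: vC vr; rewrite !inE => /forall_inP/(_ c cC)/eqP vc /forall_inP/(_ c cC).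
  by rewrite mulmxBl vc sub0r oppr_eq0.
(* Testing against g X^j, with j the degree of the residue, isolates its
   leading coefficient. *)
apply/eqP; apply/negPn/negP => r0.
pose j := (size (poly_of_word r)).-1.
have jk : (j < k)%N.
  move: r0 sr; rewrite -size_poly_gt0 /j -rE.
  by case: (size _).
pose c : 'rV[F3]_n := poly_rV (g * 'X^j).
have cE : poly_of_word c = g * 'X^j.
  by rewrite poly_of_wordE poly_rV_K // size_mulXn // sg; lia.
have cC : c \in negacyclic_code n M by rewrite inE cE dvdp_mulr.
move: rC; rewrite inE => /forall_inP/(_ c cC); rewrite eq_dot_poly.
have jn : (j < n)%N by lia.
rewrite (bigD1 (Ordinal jn)) //= big1 ?addr0.
  by rewrite cE coefMXn ltnn subnn mulf_eq0 (negPf g00) orbF lead_coef_eq0 (negPf r0).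
move=> i ij; rewrite cE coefMXn.
have [lt|ge] := ltnP i j; first by rewrite mulr0.
rewrite nth_default ?mul0r //.
have : (i : nat) != j by apply: contra ij => /eqP e0; apply/eqP/val_inj.
by move: ge; rewrite /j; move: (size _) => a; lia.
Qed.

(** * Minimum distance and the BCH bound *)

Lemma min_dist_geP n k (C : {set 'rV[F3]_n}) :
  (k <= n)%N -> (forall c, c \in C -> c != 0 -> (k <= wt c)%N) ->
  (k <= min_dist C)%N.
Proof.
move=> kn kC; rewrite /min_dist; elim/big_rec: _ => // c m /andP[cC c0] km.
by rewrite leq_min kC.
Qed.

Lemma min_dist_le n (C : {set 'rV[F3]_n}) c :
  c \in C -> c != 0 -> (min_dist C <= wt c)%N.
Proof.
(* The starting value [n] is not neutral for [minn], so the fold is unrolled by induction on the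
   enumeration. *)
move=> cC c0; rewrite /min_dist; have := mem_index_enum c.
elim: (index_enum _) => // d s IH; rewrite inE big_cons => /predU1P[<-|cs].
  by rewrite cC c0 geq_minl.
by case: ifP => _; rewrite ?geq_min IH ?orbT.
Qed.

Lemma horner_map_word (L : fieldType) (f : {rmorphism F3 -> L}) n
    (c : 'rV[F3]_n) x :
  (map_poly f (poly_of_word c)).[x] = \sum_(i < n) f (c 0 i) * x ^+ i.
Proof.
rewrite /poly_of_word rmorph_sum /= horner_sum; apply: eq_bigr => i _.
by rewrite map_polyZ map_polyXn hornerZ hornerXn.
Qed.

(* If c had at most d nonzero entries, the d vanishing conditions would make
   the values c_i beta^(a i) orthogonal to P(beta^(2 i)) for the polynomial P
   of degree wt c - 1 vanishing at all support points but one. *)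
Lemma bch_bound (L : fieldType) (f : {rmorphism F3 -> L}) n (beta : L) a d
    (c : 'rV[F3]_n) :
  (2 * n).-primitive_root beta ->
  (forall k, (k < d)%N ->
     root (map_poly f (poly_of_word c)) (beta ^+ (a + 2 * k))) ->
  c != 0 -> (d < wt c)%N.
Proof.
move=> prim zeros c0; rewrite ltnNge; apply/negP => wd.
have [i0 ci0] : exists i, c 0 i != 0.
  apply/existsP; apply: contraNT c0; rewrite negb_exists => /forallP c00.
  apply/eqP/rowP => i; rewrite mxE; apply/eqP.
  by have := c00 i; rewrite negbK.
pose S := [set i | c 0 i != 0].
pose P := \prod_(i <- enum (S :\ i0)) ('X - (beta ^+ (2 * i))%:P).
have sP : size P = wt c.
  have i0S : i0 \in S by rewrite inE.
  by rewrite size_prod_XsubC -cardE /wt -/S (cardsD1 i0 S) i0S.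
have sum0 : \sum_(i < n) f (c 0 i) * beta ^+ (a * i) * P.[beta ^+ (2 * i)] = 0.
  under eq_bigr do rewrite horner_coef mulr_sumr.
  rewrite exchange_big big1 //= => k _.
  have kd : (k < d)%N by rewrite (leq_trans (ltn_ord k)) ?sP.
  have /eqP := zeros _ kd; rewrite horner_map_word => sum0.
  transitivity (P`_k * \sum_(i < n) f (c 0 i) * (beta ^+ (a + 2 * k)) ^+ i).
    rewrite mulr_sumr; apply: eq_bigr => i _.
    rewrite mulrCA -mulrA; congr (_ * (_ * _)).
    by rewrite -!exprM -exprD; congr (_ ^+ _); lia.
  by rewrite sum0 mulr0.
(* Only the term at [i0] survives; it is nonzero because the exponents [2 * i] are distinct and
   below the order [2 * n] of [beta]. *)
have /eqP := sum0; rewrite (bigD1 i0) //= big1 ?addr0.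
  rewrite !mulf_eq0 fmorph_eq0 (negPf ci0) expf_eq0 (prim_root_eq0 prim).
  rewrite (_ : (_ == 0)%N = false) ?andbF /=; last first.
    by have := ltn_ord i0; lia.
  rewrite horner_prod prodf_seq_eq0 => /hasP[i]; rewrite mem_enum !inE /=.
  case/andP=> ii0 _; rewrite hornerXsubC subr_eq0 (eq_prim_root_expr prim).
  rewrite !modn_small ?ltn_mul2l ?ltn_ord //= eqn_mul2l /= => /eqP i0i.
  by case/eqP: ii0; apply: val_inj.
move=> i ii0; have [->|ci] := eqVneq (c 0 i) 0; first by rewrite rmorph0 !mul0r.
suff /eqP-> : P.[beta ^+ (2 * i)] == 0 by rewrite mulr0.
rewrite horner_prod prodf_seq_eq0; apply/hasP; exists i.
  by rewrite mem_enum !inE ii0.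
by rewrite /= hornerXsubC subrr.
Qed.

(** * Minimal polynomials over GF(3) and the Frobenius map *)

Lemma minpoly_dvd (L : fieldType) (f : {rmorphism F3 -> L}) M beta p :
  is_minpoly f M beta -> (M %| p) = root (map_poly f p) beta.
Proof.
case=> monM rM minM; have M0 := monic_neq0 monM.
apply/idP/idP => [/dvdpP[q ->]|rp].
  by rewrite rmorphM rootM rM orbT.
rewrite /dvdp; apply/negPn/negP => r0.
have : root (map_poly f (p %% M)) beta.
  move: rp; rewrite {1}(divp_eq p M) rmorphD rmorphM /= !rootE hornerD hornerM.
  by move/rootP: rM => ->; rewrite mulr0 add0r.
by move/(minM _ r0); rewrite leqNgt ltn_modp M0.
Qed.

(** Cubing is a ring endomorphism in characteristic 3 and fixes the coefficients, which come from
    GF(3). *)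
Lemma horner_map_Frobenius (L : fieldType) (f : {rmorphism F3 -> L})
    (p : {poly F3}) z k :
  (map_poly f p).[z ^+ (3 ^ k)] = (map_poly f p).[z] ^+ (3 ^ k).
Proof.
have chL : 3%N \in [pchar L] by apply: (rmorph_pchar f); apply: pchar_Fp.
have frob (y : L) : (map_poly f p).[y ^+ 3] = (map_poly f p).[y] ^+ 3.
  rewrite -!(pFrobenius_autE chL) -horner_map; congr _.[_].
  apply/polyP => i; rewrite !coef_map /= pFrobenius_autE -rmorphXn /=.
  by congr (f _); rewrite -{1}(expf_card p`_i) card_Fp.
by elim: k => [|k IH]; rewrite ?expr1 // expnSr !exprM frob IH.
Qed.

(* Evaluation at beta embeds the polynomials of degree < deg M into the
   roots of X^(3^k) - X. *)
Lemma minpoly_size_le (L : fieldType) (f : {rmorphism F3 -> L}) M beta k :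
  is_minpoly f M beta -> (0 < k)%N -> beta ^+ (3 ^ k) = beta ->
  (size M <= k.+1)%N.
Proof.
move=> minM k0 bk; have [monM _ _] := minM; have M0 := monic_neq0 monM.
pose d := (size M).-1.
have sM : size M = d.+1 by move: M0; rewrite -size_poly_gt0 /d; case: (size M).
pose ev (v : 'rV[F3]_d) := (map_poly f (rVpoly v)).[beta].
have ev_inj : injective ev.
  move=> u v /eqP; rewrite -subr_eq0 /ev -hornerN -hornerD -rmorphN -rmorphD /=.
  rewrite -/(root _ _) -(minpoly_dvd _ minM) -linearN -linearD /= => Mdvd.
  apply/eqP; rewrite -subr_eq0 -poly_of_word_eq0 poly_of_wordE.
  apply: contraLR Mdvd => uv0; apply/negP => /(dvdp_leq uv0).
  by rewrite sM leqNgt ltnS size_poly.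
have k3 : (1 < 3 ^ k)%N by rewrite -{1}(expn0 3) ltn_exp2l.
have sX : size ('X^(3 ^ k) - 'X : {poly L}) = (3 ^ k).+1.
  by rewrite size_polyDl ?size_polyXn // size_polyN size_polyX.
have := @max_poly_roots _ ('X^(3 ^ k) - 'X : {poly L}) (map ev (enum 'rV[F3]_d)).
rewrite -size_poly_gt0 sX size_map -cardE card_mx card_Fp // mul1n ltnS sM ltnS.
rewrite leq_exp2l //; apply=> //; last by rewrite map_inj_uniq ?enum_uniq.
apply/allP => _ /mapP[v _ ->].
by rewrite rootE !hornerE /ev -horner_map_Frobenius bk subrr.
Qed.

(** * The conjugates of [beta] *)

(** Exponents are represented below [2 * n]: the second half stands for [-3^i], which is [3^(l+i)]
    modulo [2 * n]. *)
Definition conj_exps l n :=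
  [seq (3 ^ i)%N | i <- iota 0 l] ++ [seq (2 * n - 3 ^ i)%N | i <- iota 0 l].

Lemma conj_exps_lt l n e : (4 * n = 3 ^ l + 1)%N -> (0 < l)%N ->
  e \in conj_exps l n -> (0 < e < 2 * n)%N.
Proof.
case: l => // l nE _.
have lt i : (i < l.+1)%N -> (0 < 3 ^ i)%N /\ (3 ^ i <= 3 ^ l)%N.
  by rewrite expn_gt0 leq_exp2l.
move: nE; rewrite expnS => nE.
by rewrite mem_cat => /orP[] /mapP[i]; rewrite mem_iota => /andP[_ /lt ?] ->; lia.
Qed.

Lemma conj_exps_uniq l n : (4 * n = 3 ^ l + 1)%N -> (1 < l)%N ->
  uniq (conj_exps l n).
Proof.
case: l => [|[|l]] // nE _.
have lt i : (i < l.+2)%N -> (0 < 3 ^ i)%N /\ (3 ^ i <= 3 ^ l.+1)%N.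
  by rewrite expn_gt0 leq_exp2l.
have nE' : (4 * n = 3 * 3 ^ l.+1 + 1)%N by rewrite -expnS.
rewrite cat_uniq !map_inj_in_uniq ?iota_uniq ?andbT.
- apply/hasPn => x /mapP[i]; rewrite mem_iota => /andP[_ li] ->.
  apply/negP => /mapP[j]; rewrite mem_iota => /andP[_ lj] eq.
  have [? ?] := lt _ li; have [? ?] := lt _ lj.
  (* Doubled, this reads [2 * (3^i + 3^j) = 3^l + 1] for the original [l]. Modulo 3 it fails unless
     [i = j = 0], and then the right side is too large. *)
  have sum : (3 ^ i + 3 ^ j = 2 * n)%N by lia.
  have l3 : (0 < 3 ^ l)%N by rewrite expn_gt0.
  move: sum nE'; rewrite expnS.
  by case: (i) => [|i']; case: (j) => [|j']; rewrite ?expnS ?expn0; lia.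
- move=> i j; rewrite !mem_iota => /andP[_ li] /andP[_ lj] eq.
  have [? ?] := lt _ li; have [? ?] := lt _ lj.
  by apply/eqP; rewrite -(eqn_exp2l _ _ (isT : 1 < 3)%N); apply/eqP; lia.
- by move=> i j _ _ /eqP; rewrite eqn_exp2l // => /eqP.
Qed.

(** The identity [beta^(3^(2l)) = beta] bounds the degree above, and the [2l] distinct conjugates
    bound it below; hence [M] splits over them and has no other root. *)
Lemma minpoly_conj (L : fieldType) (f : {rmorphism F3 -> L}) M beta l n :
  is_minpoly f M beta -> (2 * n).-primitive_root beta ->
  (4 * n = 3 ^ l + 1)%N -> (1 < l)%N ->
  size M = (2 * l).+1 /\
  forall e, (e < 2 * n)%N ->
    root (map_poly f M) (beta ^+ e) = (e \in conj_exps l n).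
Proof.
move=> minM prim nE l1; have [monM rM _] := minM; have M0 := monic_neq0 monM.
have eN := conj_exps_lt nE (ltnW l1).
pose rs := [seq beta ^+ e | e <- conj_exps l n].
have rs_uniq : uniq rs.
  rewrite map_inj_in_uniq ?conj_exps_uniq // => d e /eN/andP[_ dn] /eN/andP[_ en].
  by move/eqP; rewrite (eq_prim_root_expr prim) !modn_small // => /eqP.
have szrs : size rs = (2 * l)%N.
  by rewrite size_map size_cat !size_map size_iota; lia.
have root3 i : root (map_poly f M) (beta ^+ (3 ^ i)).
  by rewrite rootE horner_map_Frobenius (rootP rM) expr0n expn_eq0.
have rootN i : (i < l)%N -> beta ^+ (2 * n - 3 ^ i) = beta ^+ (3 ^ (l + i)).
  move=> il; apply/eqP; rewrite (eq_prim_root_expr prim).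
  have le : (3 ^ i <= 2 * n)%N.
    have /eN : (3 ^ i)%N \in conj_exps l n.
      by rewrite mem_cat map_f // mem_iota.
    by case/andP=> _ /ltnW.
  rewrite -(eqn_modDr (3 ^ i)) subnK // modnn expnD -{2}[(3 ^ i)%N]mul1n -mulnDl.
  by rewrite -nE (_ : 4 * n * _ = 2 * 3 ^ i * (2 * n))%N ?modnMl //; lia.
have rs_roots : all (root (map_poly f M)) rs.
  apply/allP => _ /mapP[e + ->]; rewrite mem_cat => /orP[] /mapP[i] + ->.
    by rewrite root3.
  by rewrite mem_iota => /andP[_ il]; rewrite rootN.
have fM0 : map_poly f M != 0 by rewrite map_poly_eq0.
have sM : size M = (2 * l).+1.
  apply/eqP; rewrite eqn_leq; apply/andP; split.
    apply: (minpoly_size_le minM); first by lia.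
    rewrite -[RHS]expr1; apply/eqP; rewrite (eq_prim_root_expr prim).
    rewrite mul2n -addnn expnD eqn_mod_dvd ?muln_gt0 ?expn_gt0 //.
    (* [3^(2l) - 1 = (3^l - 1)(3^l + 1)], and [3^l + 1 = 2 * (2n)]. *)
    apply/dvdnP; exists (2 * (3 ^ l - 1))%N.
    have : (0 < 3 ^ l)%N by rewrite expn_gt0.
    by move: (3 ^ l)%N nE => a nE a0; nia.
  by rewrite -(size_map_poly f M) -szrs; apply: max_poly_roots.
split=> // e en.
have -> : map_poly f M = lead_coef (map_poly f M) *: \prod_(z <- rs) ('X - z%:P).
  apply: all_roots_prod_XsubC => //; first by rewrite size_map_poly szrs.
  by rewrite uniq_rootsE.
rewrite rootZ ?lead_coef_eq0 // root_prod_XsubC.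
apply/mapP/idP => [[d dS /eqP]|eS]; last by exists e.
have /andP[_ dn] := eN _ dS.
by rewrite (eq_prim_root_expr prim) !modn_small // => /eqP->.
Qed.

(* The reciprocal polynomial of M also vanishes at beta. *)
Lemma minpoly_symmetric (L : fieldType) (f : {rmorphism F3 -> L}) M beta k s :
  is_minpoly f M beta -> size M = k.+1 -> beta != 0 ->
  beta ^+ (3 ^ s) = beta^-1 ->
  exists e : F3, forall t, (t <= k)%N -> M`_t = e * M`_(k - t).
Proof.
move=> minM sM b0 bs; have [monM rM _] := minM; have M0 := monic_neq0 monM.
pose R : {poly F3} := \poly_(i < k.+1) M`_(k - i).
have : M %| R.
  rewrite (minpoly_dvd _ minM) rootE.
  have Mb : (map_poly f M).[beta^-1] = 0.
    by rewrite -bs horner_map_Frobenius (rootP rM) expr0n expn_eq0.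
  (* The value of [R] at [beta] is [beta^k] times the value of [M] at [beta^-1]. *)
  rewrite -(mulr0 (beta ^+ k)) -Mb.
  rewrite (@horner_coef_wide _ k.+1 (map_poly f R)) ?size_map_poly ?size_poly //.
  rewrite horner_coef size_map_poly sM (reindex_inj rev_ord_inj) mulr_sumr /=.
  apply/eqP; apply: eq_bigr => -[i /= ik] _; rewrite ltnS in ik.
  rewrite !coef_map coef_poly /= subSS ltnS leq_subr subKn //= mulrCA.
  congr (_ * _).
  by rewrite -[in RHS](subnK ik) exprD exprVn mulfK // expf_neq0.
case/dvdpP => q RE.
have sq : (size q <= 1)%N.
  have [->|q0] := eqVneq q 0; first by rewrite size_poly0.
  have : (size R <= k.+1)%N by rewrite size_poly.
  by rewrite RE size_mul // sM; move: (size q) => a; lia.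
exists q`_0 => t tk.
have -> : M`_t = R`_(k - t) by rewrite coef_poly ltnS leq_subr subKn.
by rewrite RE {1}(size1_polyC sq) coefCM.
Qed.

(** * Hamming weight and sphere packing *)

Lemma wt_scale_delta n (a : F3) (i : 'I_n) : (wt ((a *: delta_mx 0 i)%R : 'rV[F3]_n) <= 1)%N.
Proof.
apply: (@leq_trans #|[set i]|); last by rewrite cards1.
apply: subset_leq_card; apply/subsetP => j.
by rewrite !inE !mxE eqxx /=; apply: contraR => /negPf->; rewrite mulr0.
Qed.

Lemma wt0 n : wt (0 : 'rV[F3]_n) = 0%N.
Proof. by apply: eq_card0 => i; rewrite !inE mxE eqxx. Qed.

Lemma wtN n (u : 'rV[F3]_n) : wt (- u) = wt u.
Proof. by apply: eq_card => i; rewrite !inE mxE oppr_eq0. Qed.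

Lemma wtD n (u v : 'rV[F3]_n) : (wt (u + v) <= wt u + wt v)%N.
Proof.
rewrite /wt; apply: leq_trans (leq_card_setU _ _).
apply: subset_leq_card; apply/subsetP => i; rewrite !inE mxE.
by case: (eqVneq (u 0 i) 0) => [->|//]; rewrite add0r.
Qed.

Lemma wt_row_mx m n (u : 'rV[F3]_m) (v : 'rV[F3]_n) :
  wt (row_mx u v) = (wt u + wt v)%N.
Proof.
rewrite /wt -!sum1_card !(big_mkcond (fun i => i \in _)) /= big_split_ord /=.
by congr (_ + _)%N; apply: eq_bigr => i _; rewrite !inE ?row_mxEl ?row_mxEr.
Qed.

(** Indexes the ball of radius 1 by a type with [2m + 1] elements; the signs give both nonzero
    scalars of GF(3). *)
Definition light_vec m (o : option ('I_m * bool)) : 'rV[F3]_m :=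
  if o is Some (i, b) then (-1) ^+ b *: delta_mx 0 i else 0.

Lemma light_vec_inj m : injective (@light_vec m).
Proof.
have nz i b : light_vec (Some (i, b)) 0 i = (-1) ^+ b.
  by rewrite !mxE !eqxx mulr1.
have sgn0 (b : bool) : (-1) ^+ b != 0 :> F3 by case: b.
case=> [[i b]|] [[j c]|] // /rowP eq.
- have := eq i; rewrite nz !mxE eqxx /=; have [->|_] := eqVneq i j.
    by rewrite mulr1; case: b c {eq} => -[] // /eqP; rewrite /eq_op.
  by rewrite mulr0 => /eqP; rewrite (negPf (sgn0 b)).
- by have := eq i; rewrite nz mxE => /eqP; rewrite (negPf (sgn0 b)).
- by have := eq j; rewrite nz mxE => /esym/eqP; rewrite (negPf (sgn0 c)).
Qed.

Lemma wt_light_vec m o : (wt (@light_vec m o) <= 1)%N.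
Proof. by case: o => [[i b]|] /=; rewrite ?wt_scale_delta ?wt0. Qed.

(* Pigeonhole: cut the positions into three blocks of length m and compare
   the (2m+1)^3 words with at most one nonzero entry in each block with the
   3^k residues modulo g; two words with the same residue differ by a word of
   weight at most 6. *)
Lemma exists_light_multiple n m k (g : {poly F3}) :
  n = (m + (m + (m + 1)))%N -> size g = k.+1 -> (3 ^ k < (2 * m + 1) ^ 3)%N ->
  exists c : 'rV[F3]_n, [/\ c \in multiples n g, c != 0 & (wt c <= 6)%N].
Proof.
move=> -> sg lt; pose T : finType := option ('I_m * bool).
(* The one position outside the three blocks is filled with 0. *)
pose word (x : T * T * T) : 'rV[F3]_(m + (m + (m + 1))) :=
  row_mx (light_vec x.1.1) (row_mx (light_vec x.1.2) (row_mx (light_vec x.2) 0)).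
have word_inj : injective word.
  move=> [[x1 x2] x3] [[y1 y2] y3] /eq_row_mx[/light_vec_inj /= -> /eq_row_mx[]].
  by move=> /light_vec_inj /= -> /eq_row_mx[/light_vec_inj /= ->].
have word_wt x : (wt (word x) <= 3)%N.
  rewrite !wt_row_mx wt0; move: (wt_light_vec x.1.1) (wt_light_vec x.1.2).
  by move: (wt_light_vec x.2); lia.
have : ~ injective (fun x => residue k g (word x)).
  move=> inj; have := leq_card _ inj; rewrite card_mx card_Fp // mul1n leqNgt.
  case/negP; rewrite !card_prod card_option card_prod card_ord card_bool.
  by apply: leq_trans lt _; rewrite (mulnC m 2) addn1 !expnS expn0 muln1 mulnA.
have [/injectiveP //|] := boolP (injectiveb (fun x => residue k g (word x))).
case/injectivePn => x [y xy eq] _; exists (word x - word y); split.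
- by rewrite -(residue_eq0 _ sg) linearB /= eq subrr.
- by rewrite subr_eq0 (inj_eq word_inj).
- apply: leq_trans (wtD _ _) _; rewrite wtN.
  by move: (word_wt x) (word_wt y); lia.
Qed.

(** * Lower bounds for the two minimum distances *)

Lemma root_map_Xn_add1 (L : fieldType) (f : {rmorphism F3 -> L}) n x :
  root (map_poly f ('X^n + 1)) x = (x ^+ n == -1).
Proof. by rewrite rmorphD rmorph1 /= map_polyXn rootE !hornerE addr_eq0. Qed.

(** With [3^(l-1) = 8y + 1], the gap lies between [2n - 3^(l-1) = 4y + 1] and [8y + 1]. It contains
    the [2y - 1] odd exponents from [4y + 3] to [8y - 1]. *)
Lemma min_dist_check_minpoly (L : fieldType) (f : {rmorphism F3 -> L}) M beta l y :
  is_minpoly f M beta -> (2 * (6 * y + 1)).-primitive_root beta ->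
  beta ^+ (6 * y + 1) = -1 -> (1 < l)%N -> (3 ^ (l - 1) = 8 * y + 1)%N ->
  (2 * y <= min_dist (negacyclic_code (6 * y + 1) M))%N.
Proof.
move=> minM prim bn l1 yE; set n := (6 * y + 1)%N in prim bn *.
case: l l1 yE => [|[|l]] // _; rewrite subn1 /= => yE.
have nE : (4 * n = 3 ^ l.+2 + 1)%N by rewrite expnS yE /n; lia.
have [sM rootsM] := minpoly_conj minM prim nE isT.
apply: min_dist_geP => [|c]; first by rewrite /n; lia.
rewrite inE => gc c0.
have dM : M %| 'X^n + 1.
  by rewrite (minpoly_dvd _ minM) root_map_Xn_add1 bn.
suff : (2 * y - 1 < wt c)%N by lia.
apply: (@bch_bound _ f _ beta (4 * y + 3)%N) => // k kd.
set e := (4 * y + 3 + 2 * k)%N.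
have e_notin : e \notin conj_exps l.+2 n.
  move: (yE) (nE); rewrite 2!expnS => yE' nE'.
  have lt i : (i < l.+2)%N -> (3 ^ i <= 3 ^ l)%N \/ (3 ^ i = 3 ^ l.+1)%N.
    rewrite ltnS leq_eqVlt => /orP[/eqP->|]; first by right.
    by rewrite ltnS leq_exp2l //; left.
  rewrite mem_cat; apply/norP; split; apply/negP => /mapP[i];
    by rewrite mem_iota => /andP[_ /lt]; rewrite /e expnS /n; lia.
(* As [e] is odd, [beta^e] is a root of [X^n + 1]; not being a root of [M], it is a root of the
   generator. *)
have: root (map_poly f ('X^n + 1)) (beta ^+ e).
  rewrite root_map_Xn_add1 -exprM mulnC exprM bn.
  by rewrite -signr_odd (_ : odd e = true) ?expr1 // /e; lia.
rewrite -(divpK dM) rmorphM rootM rootsM ?(negPf e_notin) ?orbF; last first.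
  by rewrite /e /n; lia.
by case/dvdpP: gc => q ->; rewrite rmorphM rootM => ->; rewrite orbT.
Qed.

Lemma min_dist_multiples_minpoly (L : fieldType) (f : {rmorphism F3 -> L})
    M beta l n :
  is_minpoly f M beta -> (2 * n).-primitive_root beta ->
  (4 * n = 3 ^ l + 1)%N -> (1 < l)%N -> (5 <= n)%N ->
  (5 <= min_dist (multiples n M))%N.
Proof.
move=> minM prim nE l1 n5; have [_ rootsM] := minpoly_conj minM prim nE l1.
apply: min_dist_geP => // c; rewrite inE => /dvdpP[q cE] c0.
(* [2n - 3] stands for the exponent -3; steps of 2 then reach -1, 1 and 3. *)
apply: (@bch_bound _ f _ beta (2 * n - 3)%N) => // k k4.
rewrite cE rmorphM rootM; apply/orP; right.
have b2n : beta ^+ (2 * n) = 1 by apply: prim_expr_order.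
have memS i : (i < 2)%N ->
    ((3 ^ i)%N \in conj_exps l n) && ((2 * n - 3 ^ i)%N \in conj_exps l n).
  move=> i2; have iS : i \in iota 0 l by rewrite mem_iota; lia.
  rewrite !mem_cat (map_f (fun i => 3 ^ i)%N iS).
  by rewrite (map_f (fun i => 2 * n - 3 ^ i)%N iS) orbT.
have /andP[S1 SN1] := memS 0%N isT; have /andP[S3 SN3] := memS 1%N isT.
case: k k4 => [|[|[|[|]]]] // _.
- by rewrite addn0 rootsM //; lia.
- by rewrite (_ : _ + _ = 2 * n - 1)%N ?rootsM //; lia.
- by rewrite (_ : _ + _ = 2 * n + 1)%N; [rewrite exprD b2n mul1r rootsM //|]; lia.
- by rewrite (_ : _ + _ = 2 * n + 3)%N; [rewrite exprD b2n mul1r rootsM //|]; lia.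
Qed.

Theorem theorem24 (l : nat) (Hl5 : (5 <= l)%N) (Hodd : odd l)
    (L : fieldType) (f : {rmorphism 'F_3 -> L}) (beta : L) (M : {poly 'F_3})
    (Hbeta : (2 * ((3 ^ l + 1) %/ 4)).-primitive_root beta)
    (HM : is_minpoly f M beta) :
  let n := ((3 ^ l + 1) %/ 4)%N in
  let C := negacyclic_code n M in
  [/\ code_dim C = (2 * l)%N,
      ((3 ^ (l - 1) - 1) %/ 4 <= min_dist C)%N,
      code_dim (dual_code C) = (n - 2 * l)%N
    & (5 <= min_dist (dual_code C) <= 6)%N].
Proof.
(* [l - 1] is even and 9 is 1 modulo 8. In terms of [y], the divisions by 4 in the statement are
   exact. *)
have [y yE] : exists y, (3 ^ (l - 1) = 8 * y + 1)%N.
  exists (3 ^ (l - 1) %/ 8)%N; rewrite {1}(divn_eq (3 ^ (l - 1)) 8) mulnC.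
  congr (_ + _)%N; rewrite -(odd_double_half l) Hodd add1n subn1 /= -mul2n.
  by rewrite expnM -modnXm exp1n.
have lE : (3 ^ l = 3 * (8 * y + 1))%N by rewrite -yE -expnS; congr (_ ^ _)%N; lia.
(* From [l >= 5], since [3^4 = 8 * 10 + 1]. *)
have y10 : (10 <= y)%N.
  have : (3 ^ 4 <= 3 ^ (l - 1))%N by rewrite leq_exp2l //; lia.
  by rewrite yE; lia.
have l1 : (1 < l)%N by lia.
have nE : ((3 ^ l + 1) %/ 4 = 6 * y + 1)%N by rewrite lE; lia.
rewrite nE in Hbeta *; set n := (6 * y + 1)%N in Hbeta * => m C.
rewrite {}/C {}/m.
have n4 : (4 * n = 3 ^ l + 1)%N by rewrite lE /n; lia.
have [sM _] := minpoly_conj HM Hbeta n4 l1.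
have M0 : M != 0 by rewrite -size_poly_gt0 sM.
(* [beta^n] squares to 1 but is not 1, as [beta] has order [2n]. *)
have bn : beta ^+ n = -1.
  have /eqP := prim_expr_order Hbeta; rewrite mulnC exprM sqrf_eq1.
  rewrite -(prim_order_dvd Hbeta) gtnNdvd ?orFb; [by move/eqP| |]; rewrite /n; lia.
have dM : M %| 'X^n + 1.
  by rewrite (minpoly_dvd _ HM) root_map_Xn_add1 bn.
have sX : size ('X^n + 1 : {poly F3}) = n.+1.
  by rewrite size_polyDl ?size_polyXn // size_poly1 ltnS /n; lia.
have X0 : 'X^n + 1 != 0 :> {poly F3} by rewrite -size_poly_gt0 sX.
have ln : (2 * l <= n)%N by have := dvdp_leq X0 dM; rewrite sM sX.
have [e symM] : exists e : F3, forall t, (t <= 2 * l)%N -> M`_t = e * M`_(2 * l - t).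
  have b0 : beta != 0 by rewrite (prim_root_eq0 Hbeta) /n; lia.
  apply: (minpoly_symmetric HM sM b0 (s := l)).
  (* [beta * beta^(3^l) = beta^(4n) = 1]. *)
  apply: (mulfI b0); rewrite divff // -exprS -addn1 -n4.
  rewrite (_ : 4 * n = 2 * n * 2)%N; last by lia.
  by rewrite exprM (prim_expr_order Hbeta) expr1n.
have dualE : dual_code (negacyclic_code n M) = multiples n M.
  by apply: (dual_negacyclic sM) symM => //; lia.
rewrite dualE; split.
- rewrite -[negacyclic_code n M]/(multiples n (('X^n + 1) %/ M)).
  (* The generator has degree [n - 2l]. *)
  rewrite (@code_dim_multiples n (n - 2 * l)%N) ?leq_subr ?subKn //.
  by rewrite size_divp // sX sM /= subSn.
- rewrite yE (_ : (_ %/ 4 = 2 * y)%N); last by lia.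
  exact: min_dist_check_minpoly HM Hbeta bn l1 yE.
- exact: code_dim_multiples.
- apply/andP; split.
    by apply: min_dist_multiples_minpoly HM Hbeta n4 l1 _; rewrite /n; lia.
  have [||c [cM c0 c6]] := @exists_light_multiple n (2 * y) (2 * l)%N M _ sM.
  + by rewrite /n; lia.
  (* The comparison is [(24y + 3)^2 < (4y + 1)^3], which holds for [y >= 10]. *)
  + by rewrite mulnC expnM lE; nia.
  by apply: leq_trans (min_dist_le cM c0) c6.
Qed.
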